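(* For a nonnegative integer $k$ and a positive integer $n$, let $P_{2n+k-1}(x)$ be the polynomial of degree $2n+k-1$ with Chebyshev coordinates $$[-1,0,-1,0,\ldots,-1,\underbrace{0,\ldots,0}_{k},1],$$ where $n$ is the number of entries equal to $-1$; that is, $$P_{2n+k-1}(x)=T_{2n+k-1}(x)-\sum_{j=0}^{n-1}T_{2j}(x).$$ For $k=0,1,2,3,5,7$, the polynomials $P_{2n+k-1}(x)$ are hyperbolic with all roots in the interval $[-2,2]$ except for one $x_M>2$. Moreover $\lim_{n\to\infty}x_M=z_0+z_0^{-1}$, where $z_0$ is the largest real root of the polynomial $z^{k+1}-z^{k-1}-1$ (of $z^2-z-1$ for $k=0$), while the smallest root $x_m$ approaches $-2$ as $n\to\infty$.
   Context: The Chebyshev polynomials used here are the monic integer polynomials $T_0(x)=1$ and, for $m>0$, $T_m(x)=x^m+\sum_{i=1}^{\lfloor m/2\rfloor}(-1)^i\frac mi\binom{m-i-1}{i-1}x^{m-2i}$; equivalently, for $m>0$, $T_m(2\cos\theta)=2\cos(m\theta)$ and $T_m(z+z^{-1})=z^m+z^{-m}$. Note the convention $T_0=1$ (not $2$). A polynomial has Chebyshev coordinates $[c_0,c_1,\ldots,c_d]$ if it equals $\sum_{j=0}^d c_jT_j(x)$. A real polynomial is called hyperbolic if all its complex roots are real.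
   Formalization: For n=1 all roots lie in [-2,2], so x_M>2 is claimed only for n≥2; for odd k the polynomial is even, so -x_M is a second exceptional root (both simple), and x_m then means the smallest root other than -x_M. *)

(* Defs.v *)
From HB Require Import structures.
From mathcomp Require Import all_boot all_order all_algebra.
From mathcomp Require Import all_classical all_reals all_analysis.
From mathcomp Require Import complex.

Set Implicit Arguments.
Unset Strict Implicit.
Unset Printing Implicit Defensive.

Import Order.TTheory GRing.Theory Num.Theory.
Import numFieldNormedType.Exports.

Local Open Scope classical_set_scope.
Local Open Scope ring_scope.

(* Monic Chebyshev polynomials, with T_0 = 1 rather than 2. *)
Definition chebT (F : numFieldType) (m : nat) : {poly F} :=
  if m == 0%N then 1
  else 'X^m + \sum_(1 <= i < (m./2).+1)
         ((-1) ^+ i * (m%:R / i%:R) * 'C(m - i - 1, i - 1)%:R) *: 'X^(m - 2 * i).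

(* P_{2n+k-1}, with coordinates [-1,0,-1,0,...,-1,0,...,0,1] (n entries -1,
   then k zeros before the leading 1). *)
Definition chebP (F : numFieldType) (n k : nat) : {poly F} :=
  chebT F (2 * n + k - 1) - \sum_(j < n) chebT F (2 * j).

Definition hyperbolic (R : rcfType) (p : {poly R}) : Prop :=
  forall z : R[i], root (map_poly (real_complex R) p) z -> complex.Im z = 0.

(* z^(k+1) - z^(k-1) - 1, replaced by z^2 - z - 1 when k = 0. *)
Definition limitpoly (F : numFieldType) (k : nat) : {poly F} :=
  if k == 0%N then 'X^2 - 'X - 1 else 'X^(k.+1) - 'X^(k.-1) - 1.

Definition largest_root (R : realDomainType) (p : {poly R}) (x : R) : Prop :=
  root p x /\ forall y, root p y -> y <= x.

(* The roots allowed outside [-2, 2], where a stands for x_M.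
   - For n = 1 the polynomial is T_(k+1) - 1, all of whose roots lie in
     [-2, 2].
   - For odd k the polynomial chebP F n k is even, so -x_M is a root
     whenever x_M is. *)
Definition outer_roots (F : numFieldType) (n k : nat) (a : F) : seq F :=
  if (n <= 1)%N then [::] else if odd k then [:: a; - a] else [:: a].

(* Main.v *)
(* With m = 2n-1 and x = 2 cos t, summing the Dirichlet kernel gives
     P(x) sin t = 2 sin t cos((m+k)t) - sin(mt).
   Where sin t < 1/2 the second term dominates at the extrema of sin(mt), and
   where sin t > 1/2 the first dominates at the extrema of cos((m+k)t).  These
   points, completed by t = pi/6 and t = 5pi/6 where an index would be skipped,
   form an increasing sequence along which P alternates in sign, so P has
   m + 2 floor(k/2) - 1 roots in (-2,2).  Since P(2) = 3 - 2n < 0 there is also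
   a root x_M > 2, and -x_M is one more when k is odd because P is even: this
   exhausts the degree, so all roots are real and simple.

   With x = z + 1/z and L the limit polynomial (times 1/z when k = 0),
     P(x)(z - 1/z) = z^m L(z) + z^-m (z^-k (z - 1/z) + 1),
   so P > 0 at z0 + 1/z0, while for 1 < z < z0 eventually P(z + 1/z) < 0, which
   traps x_M.  The sign changes at t = pi - 3pi/(2m) and t = pi - pi/(2m) trap
   x_m. *)
Require Import Defs.
From HB Require Import structures.
From mathcomp Require Import all_boot all_order all_algebra.
From mathcomp Require Import all_classical all_reals all_analysis.
From mathcomp Require Import complex polyrcf zify ring lra.

Set Implicit Arguments.
Unset Strict Implicit.
Unset Printing Implicit Defensive.

Import Order.TTheory GRing.Theory Num.Theory.
Import numFieldNormedType.Exports.

Local Open Scope classical_set_scope.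
Local Open Scope ring_scope.

(** * Chebyshev polynomials of both kinds *)

(* Differs from [chebT] only at 0, where the value 2 makes the recursion uniform. *)
Fixpoint dickson (F : numFieldType) (m : nat) : {poly F} :=
  if m is p.+1 then if p is q.+1 then 'X * dickson F p - dickson F q else 'X
  else 2%:R%:P.

(** The Chebyshev polynomial of the second kind, U_m(x/2). Past i = m/2 the binomial vanishes, so
    the truncated exponent does no harm. *)
Definition chebU (F : numFieldType) (m : nat) : {poly F} :=
  \sum_(i < m.+1) ((-1) ^+ i * 'C(m - i, i)%:R) *: 'X^(m - 2 * i).

Lemma dicksonSS (F : numFieldType) m :
  dickson F m.+2 = 'X * dickson F m.+1 - dickson F m.
Proof. by []. Qed.

Lemma chebU_head (F : numFieldType) m : chebU F m.+2 = 'X^(m.+2) -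
  \sum_(i < m.+1) ((-1) ^+ i * 'C((m - i).+1, i.+1)%:R) *: 'X^(m - 2 * i).
Proof.
rewrite /chebU big_ord_recl /= subn0 bin0 expr0 mul1r scale1r ?muln0 ?subn0.
congr (_ + _); rewrite big_ord_recr /= /bump ?leq0n ?add1n.
rewrite subSS subnn bin0n /= mulr0 scale0r addr0 -sumrN.
apply: eq_bigr => i _; rewrite /bump ?leq0n ?add1n exprS mulN1r mulNr scaleNr.
have le_im : (i <= m)%N by rewrite -ltnS.
by rewrite subSS subSn //; congr (- (_ *: 'X^_)); lia.
Qed.

(** Pascal's rule, coefficient by coefficient; [chebU_head] shifts the index so that the sums
    align. *)
Lemma chebU_rec (F : numFieldType) m :
  chebU F m.+2 = 'X * chebU F m.+1 - chebU F m.
Proof.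
have -> : 'X * chebU F m.+1 = 'X^(m.+2) -
    \sum_(i < m.+1) ((-1) ^+ i * 'C(m - i, i.+1)%:R) *: 'X^(m - 2 * i).
  rewrite /chebU big_ord_recl /= subn0 bin0 expr0 mul1r scale1r ?muln0 ?subn0.
  rewrite mulrDr -exprS; congr (_ + _); rewrite big_distrr /= -sumrN.
  apply: eq_bigr => i _; rewrite /bump ?leq0n ?add1n exprS mulN1r mulNr scaleNr.
  rewrite subSS mulrN -scalerAr -exprS; congr (- _).
  (* For m <= 2i truncation can make the exponents differ, but the binomial is then zero. *)
  have [le_im|lt_mi] := leqP (2 * i).+1 m; last first.
    by rewrite bin_small ?mulr0 ?scale0r //; lia.
  by congr (_ *: 'X^_); lia.
rewrite chebU_head -addrA -opprD -big_split /=; congr (_ - _).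
by apply: eq_bigr => i _; rewrite -scalerDl -mulrDr -natrD binS addnC.
Qed.

(** The classical 2 T_m = U_m - U_(m-2): both sides obey the same recurrence of order two, so two
    initial cases suffice. *)
Lemma dickson_chebU (F : numFieldType) m :
  dickson F m.+2 = chebU F m.+2 - chebU F m.
Proof.
have U0 : chebU F 0 = 1 by rewrite /chebU big_ord1 expr0 mul1r scale1r expr0.
have U1 : chebU F 1 = 'X.
  by rewrite /chebU big_ord_recr big_ord1 /= expr0 mul1r scale1r expr1
    mulr0 scale0r addr0.
have D2 : dickson F 2 = chebU F 2 - chebU F 0.
  by rewrite chebU_rec U0 U1 /= polyCD polyC1; ring.
have D3 : dickson F 3 = chebU F 3 - chebU F 1.
  by rewrite dicksonSS D2 [dickson F 1]/= (chebU_rec F 1) (chebU_rec F 0) U0 U1; ring.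
elim/ltn_ind: m => -[_|[_|m IH]]; [exact: D2|exact: D3|].
rewrite dicksonSS !IH // (chebU_rec F m.+2) (chebU_rec F m); ring.
Qed.

(** Comes down to (m/i) C(m-i-1, i-1) = C(m-i, i) + C(m-i-1, i-1), which follows from the absorption
    identity [mul_bin_diag]. *)
Lemma chebT_dickson (F : numFieldType) m : (0 < m)%N ->
  chebT F m = dickson F m.
Proof.
case: m => [|[|m]] // _; first by rewrite /chebT /= big_geq // addr0.
rewrite dickson_chebU chebU_head /chebT /= -addrA; congr (_ + _).
rewrite /chebU -opprD -big_split /= big_add1 /=.
rewrite -(big_mkord xpredT (fun i => ((-1) ^+ i * 'C((m - i).+1, i.+1)%:R)
  *: 'X^(m - 2 * i) + ((-1) ^+ i * 'C(m - i, i)%:R) *: 'X^(m - 2 * i))).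
rewrite [in RHS](@big_cat_nat _ _ _ m./2.+1) //=; last by lia.
rewrite [X in _ + X]big_nat [X in _ + X]big1 ?addr0; last first.
  move=> i /andP[lt_mi _].
  by rewrite !bin_small ?mulr0 ?scale0r ?addr0 //; lia.
rewrite -sumrN; apply: eq_big_nat => i /andP[_ le_im].
rewrite -scalerDl -mulrDr -scaleNr; congr (_ *: 'X^_); last by lia.
rewrite exprS mulN1r -!mulNr -mulrA; congr (_ * _).
have -> : (m.+2 - i.+1 - 1 = m - i)%N by lia.
have -> : (i.+1 - 1 = i)%N by lia.
have nz : i.+1%:R != 0 :> F by rewrite pnatr_eq0.
apply: (mulfI nz); rewrite mulrDr -!natrM -mul_bin_diag -natrD -mulnDl.
rewrite mulrA mulrCA divff // mulr1 -natrM; congr (_ * _)%:R; lia.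
Qed.

Lemma size_dickson (F : numFieldType) m :
  size (dickson F m.+1) = m.+2 /\ lead_coef (dickson F m.+1) = 1.
Proof.
elim/ltn_ind: m => -[_|m IH]; first by rewrite [dickson _ _]/= size_polyX lead_coefX.
have [s1 l1] := IH m (leqnn _).
have s0 : (size (dickson F m) <= m.+1)%N.
  case: m IH {s1 l1} => [_|m IH]; first exact: size_polyC_leq1.
  by have [->] := IH m (leqW (leqnn _)).
have sX : size ('X * dickson F m.+1) = m.+3.
  by rewrite mulrC size_mulX ?s1 // -size_poly_eq0 s1.
rewrite dicksonSS size_polyDl ?lead_coefDl ?size_polyN ?sX 1?ltnW //.
by split=> //; rewrite mulrC lead_coefMX.
Qed.

Lemma dickson_recip (F : numFieldType) m (u v : F) : u * v = 1 ->
  (dickson F m).[u + v] = u ^+ m + v ^+ m.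
Proof.
move=> uv1; elim/ltn_ind: m => -[_|[_|m IH]].
- by rewrite /= hornerC !expr0.
- by rewrite /= hornerX.
rewrite dicksonSS hornerD hornerN hornerM hornerX !IH //.
rewrite !exprS; transitivity (u * (u * u ^+ m) + v * (v * v ^+ m) +
  (u * v - 1) * (u ^+ m + v ^+ m)); first by ring.
by rewrite uv1; ring.
Qed.

Lemma dickson_opp (F : numFieldType) m (x : F) :
  (dickson F m).[- x] = (-1) ^+ m * (dickson F m).[x].
Proof.
elim/ltn_ind: m => -[_|[_|m IH]].
- by rewrite /= !hornerC expr0 mul1r.
- by rewrite /= !hornerX expr1 mulN1r.
rewrite dicksonSS !hornerD !hornerN !hornerM !hornerX !IH // !exprS; ring.
Qed.

(** * Degree, parity and closed forms of [chebP] *)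

Definition evenT_sum (F : numFieldType) n : {poly F} :=
  \sum_(j < n.+1) chebT F (2 * j).

Lemma evenT_sum0 (F : numFieldType) : evenT_sum F 0 = 1.
Proof. by rewrite /evenT_sum big_ord1. Qed.

Lemma evenT_sumS (F : numFieldType) n :
  evenT_sum F n.+1 = evenT_sum F n + dickson F (2 * n.+1).
Proof. by rewrite /evenT_sum big_ord_recr /= chebT_dickson //; lia. Qed.

(** Taking n.+1 entries -1 frees the degree of truncated subtraction; 2n+1 is the m of the
    trigonometric formula. *)
Lemma chebP_dickson (F : numFieldType) n k :
  chebP F n.+1 k = dickson F (2 * n + 1 + k) - evenT_sum F n.
Proof.
have -> : (2 * n + 1 + k = 2 * n.+1 + k - 1)%N by lia.
by rewrite /chebP chebT_dickson //; lia.
Qed.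

Lemma size_chebP (F : numFieldType) n k :
  size (chebP F n.+1 k) = (2 * n + k).+2 /\ chebP F n.+1 k \is monic.
Proof.
have sE : (size (evenT_sum F n) <= (2 * n).+1)%N.
  elim: n => [|n IH]; first by rewrite evenT_sum0 size_poly1.
  rewrite evenT_sumS (leq_trans (size_polyD _ _)) // geq_max.
  rewrite (leq_trans IH); last by lia.
  have -> : (2 * n.+1 = (2 * n).+1.+1)%N by lia.
  by rewrite (size_dickson F (2 * n).+1).1 leqnn.
rewrite chebP_dickson.
have -> : (2 * n + 1 + k = (2 * n + k).+1)%N by lia.
have [sD lD] := size_dickson F (2 * n + k).
have lt_sE : (size (- evenT_sum F n) < size (dickson F (2 * n + k).+1))%N.
  by rewrite size_polyN sD (leq_ltn_trans sE) //; lia.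
by rewrite size_polyDl // sD monicE lead_coefDl // lD.
Qed.

(** Because T_0 is 1 and not 2, the sum of the T_2j telescopes once multiplied by u - v. *)
Lemma chebP_recip (F : numFieldType) n k (u v : F) : u * v = 1 ->
  (chebP F n.+1 k).[u + v] * (u - v) =
  (u ^+ (2 * n + 1 + k) + v ^+ (2 * n + 1 + k)) * (u - v) -
  (u ^+ (2 * n + 1) - v ^+ (2 * n + 1)).
Proof.
move=> uv1; rewrite chebP_dickson hornerD hornerN dickson_recip // mulrBl.
congr (_ - _); elim: n => [|n IH].
  by rewrite evenT_sum0 hornerC !expr1 mul1r.
rewrite evenT_sumS hornerD mulrDl IH dickson_recip //.
have -> : (2 * n.+1 + 1 = (2 * n + 1).+2)%N by lia.
have -> : (2 * n.+1 = (2 * n + 1).+1)%N by lia.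
rewrite !exprS; set a := u ^+ _; set b := v ^+ _.
transitivity (u * (u * a) - v * (v * b) + (1 - u * v) * (a - b)); first by ring.
by rewrite uv1; ring.
Qed.

Lemma chebP_2 (F : numFieldType) n k :
  (chebP F n.+1 k).[2] = 1 - (2 * n)%:R.
Proof.
have D2 m : (dickson F m).[2] = 2.
  by have := @dickson_recip F m 1 1 (mulr1 1); rewrite !expr1n.
rewrite chebP_dickson hornerD hornerN D2.
suff -> : (evenT_sum F n).[2] = (2 * n)%:R + 1 by ring.
elim: n => [|n IH]; first by rewrite evenT_sum0 hornerC add0r.
by rewrite evenT_sumS hornerD D2 IH mulnS natrD; ring.
Qed.

Lemma chebP_opp (F : numFieldType) n k (x : F) : odd k ->
  (chebP F n.+1 k).[- x] = (chebP F n.+1 k).[x].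
Proof.
move=> ok; rewrite chebP_dickson !hornerD !hornerN dickson_opp.
have odd_deg : odd (2 * n + 1 + k) = false by lia.
rewrite -signr_odd odd_deg expr0 mul1r {odd_deg}; congr (_ - _).
elim: n => [|n IH]; first by rewrite evenT_sum0 !hornerC.
have odd_2n : odd (2 * n.+1) = false by lia.
by rewrite evenT_sumS !hornerD IH dickson_opp -signr_odd odd_2n expr0 mul1r.
Qed.

(** Proved by its own induction, since the u = e^(it) that [dickson_recip] would require is not
    real. *)
Lemma dickson_cos (R : realType) m (t : R) :
  (dickson R m).[2 * cos t] = 2 * cos (m%:R * t).
Proof.
elim/ltn_ind: m => -[_|[_|m IH]].
- by rewrite /= hornerC mul0r cos0 mulr1.
- by rewrite /= hornerX mul1r.
rewrite dicksonSS hornerD hornerN hornerM hornerX !IH //.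
have -> : m.+2%:R * t = m.+1%:R * t + t by rewrite -[m.+2]addn1 natrD; ring.
have -> : m%:R * t = m.+1%:R * t - t by rewrite -[m.+1]addn1 natrD; ring.
by rewrite cosB cosD; ring.
Qed.

Lemma chebP_cos (R : realType) n k (t : R) :
  (chebP R n.+1 k).[2 * cos t] * sin t =
  2 * sin t * cos ((2 * n + 1 + k)%:R * t) - sin ((2 * n + 1)%:R * t).
Proof.
rewrite chebP_dickson hornerD hornerN dickson_cos mulrBl.
congr (_ - _); first by ring.
elim: n => [|n IH]; first by rewrite evenT_sum0 hornerC !mul1r.
rewrite evenT_sumS hornerD mulrDl IH dickson_cos.
have -> : (2 * n.+1 + 1)%:R * t = (2 * n.+1)%:R * t + t by rewrite natrD; ring.
have -> : (2 * n + 1)%:R * t = (2 * n.+1)%:R * t - t.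
  have -> : (2 * n.+1 = 2 * n + 1 + 1)%N by lia.
  by rewrite (natrD _ (2 * n + 1)); ring.
by rewrite sinB sinD; ring.
Qed.

(** * Trigonometric estimates *)

Lemma cosBnpi (R : realType) (x : R) j : cos (x - j%:R * pi) = (-1) ^+ j * cos x.
Proof.
elim: j => [|j IH]; first by rewrite mul0r subr0 mul1r.
by rewrite -addn1 natrD mulrDl mul1r opprD addrA cosB sinpi cospi IH exprD; ring.
Qed.

Lemma sinBnpi (R : realType) (x : R) j : sin (x - j%:R * pi) = (-1) ^+ j * sin x.
Proof.
elim: j => [|j IH]; first by rewrite mul0r subr0 mul1r.
by rewrite -addn1 natrD mulrDl mul1r opprD addrA sinB sinpi cospi IH exprD; ring.
Qed.

(** With s = sin(pi/6), the triple-angle formula and sin(pi/2) = 1 give (s + 1)(2s - 1)^2 = 0. *)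
Lemma sin_pi6 (R : realType) : sin (pi / 6) = 1 / 2 :> R.
Proof.
set t := pi / 6; have pi0 := pi_gt0 R.
have s0 : 0 < sin t by apply: sin_gt0_pihalf; rewrite /t; lra.
have : sin (t + (t + t)) = 1.
  by rewrite (_ : t + (t + t) = pi / 2) ?sin_pihalf // /t; field.
have := cos2Dsin2 t; rewrite !(sinD, cosD).
move: s0; set s := sin t; set c := cos t => s0 cs e.
have : (s + 1) * (2 * s - 1) ^+ 2 = 0.
  transitivity (1 - (s * (c * c - s * s) + c * (s * c + c * s)) +
    3 * s * (c ^+ 2 + s ^+ 2 - 1)); first by ring.
  by rewrite cs e; ring.
move/eqP; rewrite mulf_eq0 sqrf_eq0 => /orP[|] /eqP; lra.
Qed.

Lemma sin_lt_half (R : realType) (t : R) : 0 < t < pi / 6 -> 0 < sin t < 1 / 2.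
Proof.
move=> /andP[t0 t6]; have pi0 := pi_gt0 R; apply/andP; split.
  by apply: sin_gt0_pi; lra.
by rewrite -sin_pi6 ltr_sin ?in_itv /=; lra.
Qed.

Lemma sin_pisub (R : realType) (t : R) : sin (pi - t) = sin t.
Proof. by rewrite sinB sinpi cospi; ring. Qed.

Lemma sin_gt_half (R : realType) (t : R) : pi / 6 < t < 5 / 6 * pi -> 1 / 2 < sin t.
Proof.
move=> /andP[t6 t56]; have pi0 := pi_gt0 R.
have [t2|t2] := lerP t (pi / 2).
  by rewrite -sin_pi6 ltr_sin ?in_itv /=; lra.
by rewrite -sin_pisub -sin_pi6 ltr_sin ?in_itv /=; lra.
Qed.

(** Sum to product: (a + b)/2 and (a - b)/2 both lie strictly between -pi/2 and pi/2. *)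
Lemma addr_cos_gt0 (R : realType) (a b : R) :
  0 <= a -> 0 <= b -> a + b < pi -> 0 < cos a + cos b.
Proof.
move=> a0 b0 ab.
have -> : cos a + cos b = 2 * cos ((a + b) / 2) * cos ((a - b) / 2).
  have sum_cos p q : cos (p + q) + cos (p - q) = 2 * cos p * cos q :> R.
    by rewrite cosB cosD; ring.
  by rewrite -sum_cos; congr (cos _ + cos _); field.
by rewrite !mulr_gt0 // cos_gt0_pihalf //; lra.
Qed.

(** * Roots from sign changes, and polynomials whose roots are all known *)

Lemma alternating_roots (R : rcfType) (p : {poly R}) (a : nat -> R) n :
  (forall i, (i < n)%N -> a i.+1 < a i /\ p.[a i] * p.[a i.+1] < 0) ->
  exists s : seq R, [/\ size s = n, uniq s, all (root p) s &
    forall x, x \in s -> a n < x < a 0%N].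
Proof.
move=> Ha; suff: a n <= a 0%N /\ exists s : seq R,
    [/\ size s = n, uniq s, all (root p) s &
        forall x, x \in s -> a n < x < a 0%N] by case.
(* The new root lies below [a n], hence differs from the earlier ones; [a n <= a 0] is carried along
   to keep it below [a 0]. *)
elim: n Ha => [|n IH] Ha; first by split=> //; exists [::].
have [|le_a [s [ss us rs s_in]]] := IH; first by move=> i /leqW; exact: Ha.
have [lt_a sgn] := Ha n (leqnn _).
have [x] := poly_ivtoo (ltW lt_a) (eq_ind _ (fun y => y < 0) sgn _ (mulrC _ _)).
rewrite in_itv /= => /andP[ax xa] rx; split; first exact: le_trans (ltW lt_a) le_a.
exists (x :: s); split=> /=; rewrite ?ss ?us ?rs ?rx ?andbT //.
  by apply/negP => /s_in /andP[/lt_trans/(_ xa)]; rewrite ltxx.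
move=> y; rewrite inE => /predU1P[->|/s_in /andP[ay ya]].
  by rewrite ax (lt_le_trans xa).
by rewrite (lt_trans lt_a).
Qed.

Section SplitRoots.
Variables (R : rcfType) (p : {poly R}) (s : seq R).
Hypotheses (p_monic : p \is monic) (p_size : size p = (size s).+1).
Hypotheses (s_uniq : uniq s) (s_root : all (root p) s).

(** As many distinct roots as the degree force a product of linear factors; the root set, simplicity
    and hyperbolicity are then read off. *)
Lemma split_prod : p = \prod_(x <- s) ('X - x%:P).
Proof.
rewrite {1}(all_roots_prod_XsubC p_size s_root) ?uniq_rootsE //.
by rewrite (monicP p_monic) scale1r.
Qed.

Lemma root_split x : root p x = (x \in s).
Proof. by rewrite split_prod root_prod_XsubC. Qed.

Lemma mup_split x : x \in s -> mup x p = 1%N.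
Proof. by move=> xs; rewrite split_prod mu_prod_XsubC count_uniq_mem // xs. Qed.

Lemma hyperbolic_split : hyperbolic p.
Proof.
move=> z; rewrite split_prod rmorph_prod /=.
rewrite (eq_bigr (fun x => 'X - (real_complex R x)%:P)); last first.
  by move=> x _; rewrite rmorphB /= map_polyX map_polyC.
rewrite -(big_map (real_complex R) xpredT (fun y => 'X - y%:P)).
by rewrite root_prod_XsubC => /mapP[x _ ->].
Qed.

End SplitRoots.

(** * Sample points where P alternates in sign *)

Variant sample_turn_spec (R : realType) (m k h j : nat) : R -> Prop :=
| SampleA u of (6 * j < m + 3)%N & u * (2 * m%:R) = 2 * j%:R - 1 & u < 1 / 6 :
    sample_turn_spec m k h j u
| SampleL of (m + 3 <= 6 * j <= m + k)%N : sample_turn_spec m k h j (1 / 6)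
| SampleB u of (m + 3 <= 6 * j <= 5 * m + 12 * h + 3)%N
    & (m + k < 6 * j < 5 * m + 5 * k)%N
    & u * (m + k)%:R = j%:R & 1 / 6 < u < 5 / 6 : sample_turn_spec m k h j u
| SampleR of (5 * m + 5 * k <= 6 * j <= 5 * m + 12 * h + 3)%N :
    sample_turn_spec m k h j (5 / 6)
| SampleC u of (5 * m + 12 * h + 3 < 6 * j)%N
    & u * (2 * m%:R) = 2 * j%:R - 4 * h%:R - 1 & 5 / 6 < u :
    sample_turn_spec m k h j u.

(* The j-th sample point, in units of pi.  The first two branches make
   sin(mt) = +-1, the last one makes cos((m+k)t) = +-1; h stands for
   floor(k/2). *)
Definition sample_turn (R : realType) (m k h j : nat) : R :=
  if (6 * j < m + 3)%N then (2 * j%:R - 1) / (2 * m%:R)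
  else if (5 * m + 12 * h + 3 < 6 * j)%N then
    (2 * j%:R - 4 * h%:R - 1) / (2 * m%:R)
  else if (6 * j <= m + k)%N then 1 / 6
  else if (5 * m + 5 * k <= 6 * j)%N then 5 / 6
  else j%:R / (m + k)%:R.

(** Clears the divisions, leaving linear conditions. A and C are extrema of sin(mt) near 0 and pi, B
    extrema of cos((m+k)t), L and R the fillers at pi/6 and 5pi/6. *)
Lemma sample_turnP (R : realType) m k h j : (0 < m)%N ->
  sample_turn_spec m k h j (sample_turn R m k h j).
Proof.
move=> m0; have M0 : 0 < m%:R :> R by rewrite ltr0n.
have K0 : 0 <= k%:R :> R by rewrite ler0n.
have toR (a b : nat) : (a < b)%N -> a%:R < b%:R :> R by rewrite ltr_nat.
rewrite /sample_turn; have [ltA|geA] := ltnP.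
  apply: SampleA => //; first by field; lra.
  by move: (toR _ _ ltA); rewrite ltr_pdivrMr ?(natrM, natrD); lra.
have [ltC|geC] := ltnP.
  apply: SampleC => //; first by field; lra.
  by move: (toR _ _ ltC); rewrite ltr_pdivlMr ?(natrM, natrD); lra.
have [leL|gtL] := leqP; first by apply: SampleL; rewrite geA.
have [leR|gtR] := leqP; first by apply: SampleR; rewrite leR.
apply: SampleB; rewrite ?geA ?gtL //; first by rewrite natrD; field; lra.
move: (toR _ _ gtL) (toR _ _ gtR); rewrite !(natrM, natrD) => lo hi.
by rewrite ltr_pdivlMr ?ltr_pdivrMr; lra.
Qed.

(* The bound on h says that at most one index falls on t = 5pi/6; it excludes
   k = 4 and k = 6, just as k <= 7 leaves at most one index on t = pi/6. *)
Section Samples.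
Variables (R : realType) (m k h : nat).
Hypotheses (m_odd : odd m) (k_le7 : (k <= 7)%N) (h_le : (12 * h <= 5 * k + 2)%N).

Let m0 : (0 < m)%N. Proof. by case: m m_odd. Qed.

Lemma sample_turn_lt j : sample_turn R m k h j < sample_turn R m k h j.+1.
Proof.
have M0 : 0 < m%:R :> R by rewrite ltr0n.
have M2 : 0 < 2 * m%:R :> R by lra.
have MK : 0 < (m + k)%:R :> R by rewrite ltr0n addn_gt0 m0.
have jS : j.+1%:R = j%:R + 1 :> R by rewrite -addn1 natrD.
case: (sample_turnP R k h j m0) => [u A1 A2 A3|L1|u B1 B2 B3 B4|R1|u C1 C2 C3];
case: (sample_turnP R k h j.+1 m0) => [v a1 a2 a3|l1|v b1 b2 b3 b4|r1|v c1 c2 c3];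
(* Index bounds rule out going back or repeating a filler, and 1/6 and 5/6 separate distinct
   branches. What remains is two consecutive points within A, B or C. *)
try (by lia); try (by lra).
- by rewrite -(ltr_pM2r M2); lra.
- by rewrite -(ltr_pM2r MK); lra.
- by rewrite -(ltr_pM2r M2); lra.
Qed.

(** By [chebP_cos], for m = 2n+1 this is the sign of P(2 cos t), up to the positive factor sin t. *)
Lemma sample_turn_sign j : (0 < j <= m + 2 * h)%N ->
  let t := pi * sample_turn R m k h j in
  0 < t < pi /\
  0 < (-1) ^+ j * (2 * sin t * cos ((m + k)%:R * t) - sin (m%:R * t)).
Proof.
move=> /andP[j0 jJ] t.
have M0 : 0 < m%:R :> R by rewrite ltr0n.
have pi0 : 0 < pi :> R := pi_gt0 R.
have toR (a b : nat) : (a <= b)%N -> a%:R <= b%:R :> R by rewrite ler_nat.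
have k7 : k%:R <= 7 :> R by rewrite ler_nat.
have hk : 12 * h%:R <= 5 * k%:R + 2 :> R by move: (toR _ _ h_le); rewrite !(natrM, natrD).
have {}j0 : 1 <= j%:R :> R by rewrite ler1n.
have {}jJ : j%:R <= m%:R + 2 * h%:R :> R by rewrite -natrM -natrD ler_nat.
(* The sign is absorbed by shifting both phases by j pi. *)
have -> : (-1) ^+ j * (2 * sin t * cos ((m + k)%:R * t) - sin (m%:R * t)) =
    2 * sin t * cos ((m + k)%:R * t - j%:R * pi) - sin (m%:R * t - j%:R * pi).
  by rewrite cosBnpi sinBnpi; ring.
have pi_lt (a b : R) : a < b -> pi * a < pi * b by rewrite ltr_pM2l.
have cos_sixths (a b : R) : 0 <= a -> 0 <= b -> a + b < 6 ->
    0 < cos (a * (pi / 6)) + cos (b * (pi / 6)).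
  move=> a0 b0 ab; apply: addr_cos_gt0; first by apply: mulr_ge0; lra.
    by apply: mulr_ge0; lra.
  by rewrite -mulrDl; have := pi_lt _ _ ab; lra.
(* Towards pi the index runs 2h ahead of the extrema of sin(mt); 2h being even, signs still
   match. *)
have Nsin y : - sin y = cos (y + pi / 2 + 2 * h%:R * pi) :> R.
  have -> : 2 * h%:R * pi = pi *+ 2 *+ h :> R by rewrite -(mulr_natl (pi *+ 2)) -(mulr_natl pi); ring.
  by rewrite (periodicn (@cosD2pi R)) cosDpihalf.
have small (c : R) : 0 < sin t < 1 / 2 -> -1 <= c <= 1 -> 0 < 2 * sin t * c + 1.
  move=> /andP[s0 s2] /andP[c1 c2].
  have : 0 <= sin t * (c + 1) by apply: mulr_ge0; lra.
  lra.
rewrite /t {t} in small *.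
case: (sample_turnP R k h j m0) small => [u A1 A2 A3|L1|u B1 B2 B3 B4|R1|u C1 C2 C3] small.
- have u0 : 0 < u by rewrite -(pmulr_lgt0 u (_ : 0 < 2 * m%:R)) //; lra.
  have t0 := pi_lt _ _ u0; have t6 := pi_lt _ _ A3.
  split; first by apply/andP; split; lra.
  have -> : m%:R * (pi * u) - j%:R * pi = - (pi / 2) :> R.
    by have -> : j%:R = (u * (2 * m%:R) + 1) / 2 :> R; [lra|field].
  rewrite sinN sin_pihalf opprK small ?cos_geN1 ?cos_le1 //.
  by apply: sin_lt_half; apply/andP; split; lra.
- have [{L1}lo hi] : m%:R + 3 <= 6 * j%:R :> R /\ 6 * j%:R <= m%:R + k%:R :> R.
    by case/andP: L1 => /toR + /toR; rewrite !(natrM, natrD).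
  split; first by apply/andP; split; lra.
  have -> : pi * (1 / 6) = pi / 6 :> R by field.
  rewrite sin_pi6 mulrCA divff // mulr1 mul1r -cosDpihalf -[X in _ + X]cosN.
  (* Both coefficients of pi/6 are nonnegative and add up to k - 3 < 6. *)
  have -> : (m + k)%:R * (pi / 6) - j%:R * pi =
    (m%:R + k%:R - 6 * j%:R) * (pi / 6) :> R by rewrite natrD; field.
  have -> : - (m%:R * (pi / 6) - j%:R * pi + pi / 2) =
    (6 * j%:R - (m%:R + 3)) * (pi / 6) :> R by field.
  by apply: cos_sixths; lra.
- have [/pi_lt lo /pi_lt hi] := andP B4.
  have sin_t : 1 / 2 < sin (pi * u) by apply: sin_gt_half; apply/andP; split; lra.
  split; first by apply/andP; split; lra.
  have -> : (m + k)%:R * (pi * u) - j%:R * pi = 0 :> R by rewrite -B3; ring.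
  by rewrite cos0 mulr1 subr_gt0; apply: le_lt_trans (sin_le1 _) _; lra.
- have [{R1}lo hi] : 5 * m%:R + 5 * k%:R <= 6 * j%:R :> R /\
      6 * j%:R <= 5 * m%:R + 12 * h%:R + 3 :> R.
    by case/andP: R1 => /toR + /toR; rewrite !(natrM, natrD).
  split; first by apply/andP; split; lra.
  have -> : sin (pi * (5 / 6)) = 1 / 2 :> R.
    by rewrite -sin_pisub -sin_pi6; congr sin; field.
  rewrite mulrCA divff // mulr1 mul1r Nsin -cosN.
  (* The coefficients now add up to 12h + 3 - 5k, at most 5 by the bound on h. *)
  have -> : - ((m + k)%:R * (pi * (5 / 6)) - j%:R * pi) =
    (6 * j%:R - (5 * m%:R + 5 * k%:R)) * (pi / 6) :> R by rewrite natrD; field.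
  have -> : m%:R * (pi * (5 / 6)) - j%:R * pi + pi / 2 + 2 * h%:R * pi =
    (5 * m%:R + 12 * h%:R + 3 - 6 * j%:R) * (pi / 6) :> R by field.
  by apply: cos_sixths; lra.
- have u1 : u < 1 by rewrite -(ltr_pM2r (_ : 0 < 2 * m%:R)) //; lra.
  have t5 := pi_lt _ _ C3; have t1 := pi_lt _ _ u1.
  split; first by apply/andP; split; lra.
  rewrite Nsin.
  have -> : m%:R * (pi * u) - j%:R * pi + pi / 2 + 2 * h%:R * pi = 0 :> R.
    have -> : j%:R = (u * (2 * m%:R) + 4 * h%:R + 1) / 2 :> R by lra.
    by field.
  rewrite cos0 small ?cos_geN1 ?cos_le1 //.
  by rewrite -sin_pisub; apply: sin_lt_half; apply/andP; split; lra.
Qed.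

End Samples.

(** * Roots in (-2, 2) *)

Lemma sign_alternation (R : realDomainType) j (a b : R) :
  0 < (-1) ^+ j * a -> 0 < (-1) ^+ j.+1 * b -> a * b < 0.
Proof.
move=> ha hb; have := mulr_gt0 ha hb.
have -> : (-1) ^+ j * a * ((-1) ^+ j.+1 * b) = - (a * b) * ((-1) ^+ j) ^+ 2.
  by rewrite exprS; ring.
by rewrite sqrr_sign mulr1 oppr_gt0.
Qed.

(** The ends t = 0 and t = pi are allowed because [chebP1_roots] samples there; the roots still fall
    strictly inside. *)
Lemma alternating_cos_roots (R : realType) (p : {poly R}) (t : nat -> R) n :
  (forall j, (j <= n)%N -> 0 <= t j <= pi /\ 0 < (-1) ^+ j * p.[2 * cos (t j)]) ->
  (forall j, (j < n)%N -> t j < t j.+1) ->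
  exists s : seq R, [/\ size s = n, uniq s, all (root p) s &
    forall x, x \in s -> -2 < x < 2].
Proof.
move=> sgn mono.
have [i lt_in|s [ss us rs s_in]] :=
    @alternating_roots R p (fun j => 2 * cos (t j)) n.
  have [ti si] := sgn i (ltnW lt_in); have [tj sj] := sgn i.+1 lt_in.
  split; last exact: sign_alternation si sj.
  by rewrite ltr_pM2l // ltr_cos ?in_itv //= mono.
exists s; split=> // x /s_in /andP[lo hi].
have := cos_geN1 (t n); have := cos_le1 (t 0%N); lra.
Qed.

Lemma inner_roots (R : realType) n k h : (k <= 7)%N -> (12 * h <= 5 * k + 2)%N ->
  exists s : seq R, [/\ size s = (2 * n + 2 * h)%N, uniq s,
    all (root (chebP R n.+1 k)) s & forall x, x \in s -> -2 < x < 2].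
Proof.
move=> k7 hk; set m := (2 * n + 1)%N.
have m_odd : odd m by rewrite /m; lia.
have pi0 := pi_gt0 R.
(* Sample points are numbered from 1, so the parity is restored by passing to -P. *)
have [j le_jn|j _|s [ss us rs s_in]] := @alternating_cos_roots R
  (- chebP R n.+1 k) (fun j => pi * sample_turn R m k h j.+1) (2 * n + 2 * h).
- have [] := @sample_turn_sign R m k h m_odd k7 hk j.+1; first by rewrite /m; lia.
  set t := pi * _ => t_in; rewrite -chebP_cos => sgn.
  have [t0 t1] := andP t_in; split; first by rewrite !ltW.
  rewrite -(pmulr_lgt0 _ (sin_gt0_pi t_in)) hornerN -mulrA mulNr.
  by move: sgn; rewrite exprS mulN1r mulNr mulrN.
- by rewrite ltr_pM2l // sample_turn_lt.
exists s; split=> //; apply: sub_all rs => x; by rewrite rootN.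
Qed.

(** At the k+2 extrema of T_(k+1) the polynomial T_(k+1) - 1 is alternately 1 and -3, which yields
    all k+1 roots. *)
Lemma chebP1_roots (R : realType) k :
  exists s : seq R, [/\ size s = k.+1, uniq s,
    all (root (chebP R 1 k)) s & forall x, x \in s -> -2 < x < 2].
Proof.
have pi0 := pi_gt0 R; have k0 : 0 < k.+1%:R :> R by rewrite ltr0n.
apply: (@alternating_cos_roots R _ (fun j => j%:R / k.+1%:R * pi)) => j lt_jk.
  split.
    apply/andP; split; first by rewrite mulr_ge0 ?divr_ge0 ?ler0n // ltW.
    by rewrite ger_pMl // ler_pdivrMr // mul1r ler_nat.
  rewrite chebP_dickson evenT_sum0 hornerD hornerN hornerC muln0 add0n add1n.
  rewrite dickson_cos.
  have -> : k.+1%:R * (j%:R / k.+1%:R * pi) = - (0 - j%:R * pi) :> R.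
    by field; rewrite gt_eqF.
  rewrite cosN cosBnpi cos0 -signr_odd; case: odd; rewrite ?expr1 ?expr0; lra.
by rewrite !ltr_pM2r ?invr_gt0 // ltr_nat.
Qed.

(** The bound uses 1/(n+1) in place of the sharper 1/m so that the harmonic sequence gives the
    limit. *)
Lemma root_near_minus2 (R : realType) n k : (4 < n)%N ->
  exists2 x : R, root (chebP R n.+1 k) x &
    -2 <= x <= - 2 * cos (3 * pi / 2 * n.+1%:R^-1).
Proof.
move=> n4; have pi0 := pi_gt0 R; set m := (2 * n + 1)%N.
have m_odd : odd m by rewrite /m; lia.
have m9 : 9 < m%:R :> R by rewrite ltr_nat /m; lia.
have n5 : 5 <= n.+1%:R :> R by rewrite ler_nat; lia.
have nm : n.+1%:R <= m%:R :> R by rewrite ler_nat /m; lia.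
(* Used at c = 1 and c = 3, where sin(mt) is 1 and -1; m > 9 puts both points below pi/6, so the
   cosine term has modulus less than 1. *)
pose t (c : R) := c * pi / 2 * m%:R^-1.
have t_bd c : 0 < c <= 3 -> 0 < t c < pi / 6.
  move=> /andP[c0 c3]; apply/andP; split.
    by rewrite mulr_gt0 ?invr_gt0 ?divr_gt0 ?mulr_gt0 //; lra.
  rewrite ltr_pdivrMr; last by lra.
  have : c * pi <= 3 * pi by rewrite ler_pM2r.
  have : pi * 9 < pi * m%:R :> R by rewrite ltr_pM2l.
  by lra.
have P_at c : (chebP R n.+1 k).[2 * cos (pi - t c)] * sin (t c) =
    2 * sin (t c) * cos ((m + k)%:R * (pi - t c)) - sin (c * pi / 2).
  rewrite -{1}sin_pisub chebP_cos sin_pisub -/m; congr (_ - _).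
  have -> : m%:R * (pi - t c) = - (c * pi / 2 - m%:R * pi) :> R.
    by rewrite /t; field; lra.
  by rewrite sinN sinBnpi -signr_odd m_odd expr1 mulN1r opprK.
have sin3 : sin (3 * pi / 2) = -1 :> R.
  have -> : 3 * pi / 2 = pi / 2 + pi :> R by field.
  by rewrite sinDpi sin_pihalf.
have bd1 : 0 < t 1 < pi / 6 by apply: t_bd; lra.
have bd3 : 0 < t 3 < pi / 6 by apply: t_bd; lra.
have /andP[s10 s12] := sin_lt_half bd1; have /andP[s30 s32] := sin_lt_half bd3.
have lt_t : t 1 < t 3.
  by rewrite /t ltr_pM2r ?invr_gt0; lra.
have small (s c : R) : 0 < s < 1 / 2 -> -1 <= c <= 1 -> -1 < 2 * s * c < 1.
  move=> /andP[s0 s2] /andP[c1 c2].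
  have : 0 <= s * (c + 1) by apply: mulr_ge0; lra.
  have : 0 <= s * (1 - c) by apply: mulr_ge0; lra.
  lra.
have cos_bd (x : R) : -1 <= cos x <= 1 by rewrite cos_geN1 cos_le1.
have P1 : (chebP R n.+1 k).[2 * cos (pi - t 1)] < 0.
  rewrite -(pmulr_llt0 _ s10) P_at mul1r sin_pihalf subr_lt0.
  by have /andP[] := small _ _ (sin_lt_half bd1) (cos_bd ((m + k)%:R * (pi - t 1))).
have P3 : 0 < (chebP R n.+1 k).[2 * cos (pi - t 3)].
  rewrite -(pmulr_lgt0 _ s30) P_at sin3 subr_gt0.
  by have /andP[] := small _ _ (sin_lt_half bd3) (cos_bd ((m + k)%:R * (pi - t 3))).
have le13 : 2 * cos (pi - t 1) <= 2 * cos (pi - t 3).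
  by rewrite ler_pM2l // ltW // ltr_cos ?in_itv /=; lra.
have [|x] := @poly_ivtoo R (chebP R n.+1 k) _ _ le13; first by rewrite nmulr_rlt0.
rewrite in_itv /= => /andP[x1 x3] rx; exists x => //.
have cos_pisub (y : R) : cos (pi - y) = - cos y by rewrite cosB sinpi cospi; ring.
apply/andP; split; first by have := cos_geN1 (pi - t 1); lra.
apply: le_trans (ltW x3) _; rewrite cos_pisub mulrN -mulNr ler_nM2l ?oppr_lt0 //.
have le_t : t 3 <= 3 * pi / 2 * n.+1%:R^-1.
  by rewrite /t ler_pM2l ?lef_pV2 ?posrE; lra.
have le_pi : 3 * pi / 2 * n.+1%:R^-1 <= pi :> R.
  rewrite ler_pdivrMr; last by lra.
  have : pi * 5 <= pi * n.+1%:R :> R by rewrite ler_pM2l.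
  by lra.
have /andP[t30 _] := bd3.
move: le_t le_pi; set y := _ * _^-1; clearbody y => le_t le_pi.
by rewrite leNgt ltr_cos ?in_itv /= -?leNgt //; lra.
Qed.

(** * The limit polynomial and the root beyond 2 *)

Lemma limitpolyE (F : numFieldType) k (y : F) : (limitpoly F k).[y] =
  if k is p.+1 then y ^+ p * (y ^+ 2 - 1) - 1 else y ^+ 2 - y - 1.
Proof.
case: k => [|p]; rewrite /limitpoly /= !hornerE //.
by rewrite !exprS; ring.
Qed.

Lemma limitpoly_lt (R : realFieldType) k (a b : R) : 1 <= a -> a < b ->
  (limitpoly R k).[a] < (limitpoly R k).[b].
Proof.
move=> a1 ab; have lt_sqr : a ^+ 2 < b ^+ 2.
  by rewrite -subr_gt0 subr_sqr mulr_gt0 //; lra.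
rewrite !limitpolyE; case: k => [|p]; last first.
  rewrite ltrD2r; apply: (@le_lt_trans _ _ (b ^+ p * (a ^+ 2 - 1))).
    apply: ler_wpM2r; first by rewrite subr_ge0 exprn_ege1.
    by apply: lerXn2r; rewrite ?nnegrE; lra.
  by rewrite ltr_pM2l ?ltrD2r // exprn_gt0 //; lra.
have : 0 < (b - a) * (b + a - 1) by apply: mulr_gt0; lra.
have -> : (b - a) * (b + a - 1) = b ^+ 2 - b - 1 - (a ^+ 2 - a - 1) by ring.
by rewrite subr_gt0.
Qed.

(** The value at 1 is -1 and the value at 2 is positive; monotonicity on [1, oo) makes the root
    between them the largest. *)
Lemma limitpoly_largest_root (R : rcfType) k : exists z0 : R,
  [/\ 1 < z0, largest_root (limitpoly R k) z0 &
      forall y, 1 <= y < z0 -> (limitpoly R k).[y] < 0].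
Proof.
have L1 : (limitpoly R k).[1] < 0.
  by rewrite limitpolyE; case: k => [|p]; rewrite !expr1n; lra.
have L2 : 0 < (limitpoly R k).[2].
  rewrite limitpolyE; case: k {L1} => [|p]; first by rewrite expr2; lra.
  have : 1 <= 2 ^+ p :> R by apply: exprn_ege1; lra.
  by rewrite expr2; lra.
have [||z0] := @poly_ivtoo R (limitpoly R k) 1 2; first by lra.
  by rewrite nmulr_rlt0.
rewrite in_itv /= => /andP[z1 _] rz; exists z0; split=> // [|y /andP[y1 yz]].
  split=> // y ry; rewrite leNgt; apply/negP => /(limitpoly_lt k (ltW z1)).
  by rewrite (eqP rz) (eqP ry) ltxx.
by have := limitpoly_lt k y1 yz; rewrite (eqP rz).
Qed.

Lemma chebP_limitpoly (F : numFieldType) n k (u : F) : u != 0 ->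
  (chebP F n.+1 k).[u + u^-1] * (u - u^-1) =
  u ^+ (2 * n + 1) * ((limitpoly F k).[u] * (if k is 0 then u^-1 else 1)) +
  u^-1 ^+ (2 * n + 1) * (u^-1 ^+ k * (u - u^-1) + 1).
Proof.
move=> u0; rewrite chebP_recip ?divff // !(exprD _ _ k).
have -> : (limitpoly F k).[u] * (if k is 0 then u^-1 else 1) =
    u ^+ k * (u - u^-1) - 1.
  by rewrite limitpolyE; case: k => [|p]; rewrite ?expr0 ?exprS; field.
ring.
Qed.

Lemma limit_factor_gt0 (F : numFieldType) k (u : F) : 0 < u ->
  0 < (if k is 0 then u^-1 else 1).
Proof. by case: k; rewrite ?invr_gt0 ?ltr01. Qed.

Lemma subV_gt0 (F : numFieldType) (u : F) : 1 < u -> 0 < u - u^-1.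
Proof.
by move=> u1; rewrite subr_gt0 (lt_trans _ u1) // invf_lt1 // (lt_trans ltr01).
Qed.

Lemma addV_gt2 (R : realFieldType) (u : R) : 1 < u -> 2 < u + u^-1.
Proof.
move=> u1; have : 0 < (u - 1) ^+ 2 / u by rewrite divr_gt0 ?exprn_gt0 //; lra.
by have -> : (u - 1) ^+ 2 / u = u + u^-1 - 2; [field; lra|rewrite subr_gt0].
Qed.

(** In [chebP_limitpoly] the growing term vanishes at z and the other one is positive. *)
Lemma chebP_limit_root_gt0 (F : numFieldType) n k (z : F) : 1 < z ->
  root (limitpoly F k) z -> 0 < (chebP F n.+1 k).[z + z^-1].
Proof.
move=> z1 /eqP rz; have z0 : 0 < z := lt_trans ltr01 z1.
have d0 := subV_gt0 z1; rewrite -(pmulr_lgt0 _ d0) chebP_limitpoly ?gt_eqF //.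
rewrite rz mul0r mulr0 add0r mulr_gt0 ?exprn_gt0 ?invr_gt0 //.
by rewrite addr_gt0 // mulr_gt0 // exprn_gt0 ?invr_gt0.
Qed.

Lemma exprn_unbounded (R : archiRealFieldType) (z A : R) : 1 < z ->
  exists N, forall n, (N <= n)%N -> A < z ^+ n.
Proof.
move=> z1; have bernoulli n : n%:R * (z - 1) <= z ^+ n.
  elim: n => [|n IH]; first by rewrite mul0r.
  have : 1 <= z ^+ n by apply: exprn_ege1; lra.
  move=> /(ler_wpM2l (_ : 0 <= z - 1)); rewrite exprS -addn1 natrD; lra.
exists (Num.bound `|A / (z - 1)|) => n le_Nn.
apply: lt_le_trans (bernoulli n); rewrite -ltr_pdivrMr ?subr_gt0 //.
apply: le_lt_trans (ler_norm _) _; apply: lt_le_trans (archi_boundP (normr_ge0 _)) _.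
by rewrite ler_nat.
Qed.

(** In [chebP_limitpoly] the growing term tends to -oo, while the other stays at most z - 1/z +
    1. *)
Lemma chebP_eventually_lt0 (R : realType) k (z : R) : 1 < z ->
  (limitpoly R k).[z] < 0 ->
  exists N, forall n, (N <= n)%N -> (chebP R n.+1 k).[z + z^-1] < 0.
Proof.
move=> z1 Lz; have z0 : 0 < z := lt_trans ltr01 z1.
have d0 := subV_gt0 z1.
pose h : R := (limitpoly R k).[z] * (if k is 0 then z^-1 else 1).
have h0 : h < 0 by rewrite pmulr_llt0 ?limit_factor_gt0.
have [N hN] := exprn_unbounded ((z - z^-1 + 1) / - h) z1.
exists N => n le_Nn; rewrite -(pmulr_llt0 _ d0) chebP_limitpoly ?gt_eqF // -/h.
have V1 : 0 <= z^-1 <= 1 by rewrite invr_ge0 invf_le1 // !ltW.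
have [V0 Vle] := andP V1.
have Vd : z^-1 ^+ k * (z - z^-1) + 1 <= z - z^-1 + 1.
  by rewrite lerD2r ger_pMl // exprn_ile1.
have V2 : z^-1 ^+ (2 * n + 1) * (z^-1 ^+ k * (z - z^-1) + 1) <= z - z^-1 + 1.
  apply: le_trans Vd; rewrite ger_pMl ?exprn_ile1 //.
  by rewrite ltr_wpDl // mulr_ge0 ?exprn_ge0 // ltW.
have := hN (2 * n + 1)%N; rewrite ltr_pdivrMr ?oppr_gt0 // => hn.
have {hn} : z - z^-1 + 1 < z ^+ (2 * n + 1) * - h by apply: hn; lia.
lra.
Qed.

(** * The complete root list and the two limits *)

Lemma seq_min (R : realDomainType) (s : seq R) : s != [::] ->
  exists2 x, x \in s & forall y, y \in s -> x <= y.
Proof.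
elim: s => // a [|b s] IH _.
  by exists a => [|y]; rewrite mem_seq1 // => /eqP ->.
have [//|x xs x_min] := IH.
have [ax|xa] := lerP a x.
  exists a => [|y]; first exact: mem_head.
  by rewrite inE => /predU1P[->//|/x_min]; exact: le_trans.
exists x => [|y]; first by rewrite inE xs orbT.
by rewrite inE => /predU1P[->|/x_min //]; exact: ltW.
Qed.

(** The degree 2n+1+k is exhausted by 2n + 2 floor(k/2) inner roots, the root a between 2 and x0,
    and -a when k is odd. *)
Lemma chebP_root_list (R : realType) n k (x0 : R) :
  (k <= 7)%N -> (12 * k./2 <= 5 * k + 2)%N -> (0 < n)%N ->
  2 < x0 -> 0 < (chebP R n.+1 k).[x0] ->
  exists a s,
    [/\ 2 < a, s != [::] & forall x, x \in s -> -2 < x < 2] /\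
    [/\ uniq (outer_roots n.+1 k a ++ s),
        all (root (chebP R n.+1 k)) (outer_roots n.+1 k a ++ s) &
        size (chebP R n.+1 k) = (size (outer_roots n.+1 k a ++ s)).+1].
Proof.
move=> k7 hk n0 x2 P0; have [s [ss us rs s_in]] := @inner_roots R n k k./2 k7 hk.
have P2 : (chebP R n.+1 k).[2] < 0 by rewrite chebP_2 subr_lt0 ltr1n; lia.
have [|a] := @poly_ivtoo R (chebP R n.+1 k) _ _ (ltW x2); first by rewrite nmulr_rlt0.
rewrite in_itv /= => /andP[a2 _] ra; exists a, s.
have a_s : a \notin s by apply/negP => /s_in; lra.
have Na_s : - a \notin s by apply/negP => /s_in; lra.
have rNa : odd k -> root (chebP R n.+1 k) (- a).
  by move=> ok; rewrite /root chebP_opp.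
rewrite (size_chebP R n k).1 /outer_roots ltnS leqNgt n0 /=.
split; first by split=> //; rewrite -size_eq0 ss; lia.
have [ok|ek] := ifPn.
  rewrite /= inE negb_or a_s Na_s us ra rNa //= rs ss.
  split=> //; last by lia.
  by rewrite andbT gt_eqF //; lra.
by rewrite /= a_s us ra rs ss; split=> //; lia.
Qed.

Theorem theorem4p2 (R : realType) (k : nat)
    (hk : k \in [:: 0; 1; 2; 3; 5; 7]%N) :
  exists (z0 : R) (xM xm : nat -> R),
    [/\ largest_root (limitpoly R k) z0,
        forall n : nat, (0 < n)%N ->
          [/\ hyperbolic (chebP R n k),
              forall x, x \in outer_roots n k (xM n) -> mup x (chebP R n k) = 1%N,
              forall x, root (chebP R n k) x -> x \notin outer_roots n k (xM n) ->
                -2 <= x <= 2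
            & (1 < n)%N -> 2 < xM n],
        forall n : nat, (1 < n)%N ->
          [/\ root (chebP R n k) (xm n),
              odd k -> xm n != - xM n
            & forall x, root (chebP R n k) x -> (odd k -> x != - xM n) ->
                xm n <= x],
        xM n @[n --> \oo] --> z0 + z0^-1
      & xm n @[n --> \oo] --> (-2 : R)].

Proof.
have [k7 hh] : (k <= 7)%N /\ (12 * k./2 <= 5 * k + 2)%N.
  by move: hk; rewrite !inE => /or4P[|||/or3P[||]] /eqP ->.
have [z0 [z01 z0_largest z0_neg]] := limitpoly_largest_root R k.
set x0 := z0 + z0^-1.
have x02 : 2 < x0 := addV_gt2 z01.
have P0 n : 0 < (chebP R n.+1 k).[x0].
  by apply: chebP_limit_root_gt0 => //; case: z0_largest.
(* Each pair is (x_M, x_m). Uniqueness of the root beyond 2 is recorded for the limit of x_M. *)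
have /choice[f fP] : forall n : nat, exists p : R * R, (0 < n)%N ->
    [/\ hyperbolic (chebP R n k),
        forall x, x \in outer_roots n k p.1 -> mup x (chebP R n k) = 1%N &
        forall x, root (chebP R n k) x -> x \notin outer_roots n k p.1 ->
          -2 <= x <= 2] /\
    ((1 < n)%N ->
      [/\ 2 < p.1, root (chebP R n k) p.2, -2 < p.2 < 2,
          forall x, root (chebP R n k) x -> (odd k -> x != - p.1) ->
            p.2 <= x &
          forall x, root (chebP R n k) x -> 2 < x -> x = p.1]).
  case=> [|[|n]]; first by exists (0, 0).
    (* For n = 1 the value is a dummy: [outer_roots] is empty whatever it is. *)
    exists (0, 0) => _; split=> //.
    have [s [ss us rs s_in]] := chebP1_roots R k.
    have [sP mP] := size_chebP R 0 k; rewrite -ss in sP.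
    split=> //; first exact: hyperbolic_split mP sP us rs.
    by move=> x; rewrite (root_split mP sP us rs) => /s_in /andP[? ?]; rewrite !ltW.
  have [a [s [[a2 s0 s_in] [ur rr sr]]]] :=
    @chebP_root_list R n.+1 k x0 k7 hh isT x02 (P0 _).
  have [_ mP] := size_chebP R n.+1 k.
  have rootE := root_split mP sr ur rr.
  have [b bs b_min] := seq_min s0.
  exists (a, b) => _; split; last move=> _; split=> //=.
  - exact: hyperbolic_split mP sr ur rr.
  - by move=> x x_out; rewrite (mup_split mP sr ur rr) // mem_cat x_out.
  - move=> x; rewrite rootE mem_cat => /orP[->//|/s_in /andP[? ?] _].
    by rewrite !ltW.
  - by rewrite rootE mem_cat bs orbT.
  - exact: s_in.
  - move=> x; rewrite rootE mem_cat => /orP[|/b_min //].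
    have ba : b <= a by have := s_in _ bs; lra.
    rewrite /outer_roots /=; case: ifP => _; rewrite !inE.
      by case/orP => /eqP -> // /(_ isT); rewrite eqxx.
    by move/eqP ->.
  - move=> x; rewrite rootE mem_cat => /orP[|/s_in]; last by lra.
    rewrite /outer_roots /=; case: ifP => _; rewrite !inE.
      by case/orP => /eqP -> //; lra.
    by move/eqP ->.
exists z0, (fun n => (f n).1), (fun n => (f n).2).
split=> //.
- by move=> n n0; have [[h m r] g] := fP n n0; split=> // /g[].
- move=> n n1; have [_ /(_ n1)[a2 rb b_in b_min _]] := fP n (ltnW n1).
  by split=> // _; rewrite gt_eqF //; lra.
- apply/cvgrPdist_lt => e e0; rewrite -/x0.
  (* The maximum keeps z1 above 1 and within e of z0. *)
  pose z1 := Num.max ((1 + z0) / 2) (z0 - e / 2).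
  have z1_lt : z1 < z0 by rewrite /z1 gt_max; lra.
  have z1_gt : 1 < z1 by rewrite /z1 lt_max; lra.
  have z1_e : z0 - e < z1 by rewrite /z1 lt_max; lra.
  have [x1_lt x1_e] : z1 + z1^-1 < x0 /\ x0 - e < z1 + z1^-1.
    have w_gt0 : 0 < (z0 * z1)^-1 by rewrite invr_gt0 mulr_gt0 //; lra.
    have w_lt1 : (z0 * z1)^-1 < 1.
      by rewrite invf_lt1 ?mulr_egt1 // mulr_gt0 //; lra.
    (* Beyond 1 the map z + 1/z is increasing and does not expand distances. *)
    have dist_x1 : x0 - (z1 + z1^-1) = (z0 - z1) * (1 - (z0 * z1)^-1).
      by rewrite /x0; field; rewrite !gt_eqF //; lra.
    have : 0 < (z0 - z1) * (1 - (z0 * z1)^-1) by apply: mulr_gt0; lra.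
    have : 0 < (z0 - z1) * (z0 * z1)^-1 by apply: mulr_gt0; lra.
    split; lra.
  have [|N hN] := @chebP_eventually_lt0 R k z1 z1_gt.
    by apply: z0_neg; rewrite (ltW z1_gt) z1_lt.
  exists N.+2 => // -[|[|n]] //= le_Nn.
  have [_ /(_ isT)[a2 _ _ _ a_uniq]] := fP n.+2 isT.
  (* The sign change gives a root beyond 2 within e of x0, and uniqueness identifies it with x_M. *)
  have [|x] := @poly_ivtoo R (chebP R n.+2 k) _ _ (ltW x1_lt).
    by rewrite nmulr_rlt0 ?P0 // hN //; lia.
  rewrite in_itv /= => /andP[x1 xx0] rx.
  have x2 : 2 < x by have := addV_gt2 z1_gt; lra.
  by rewrite -(a_uniq _ rx x2) ltr_norml; lra.
- rewrite -cvg_shiftS.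
  apply: (@squeeze_cvgr _ _ _ _ (fun=> -2)
    (fun n => - 2 * cos (3 * pi / 2 * n.+1%:R^-1))).
  + exists 5%N => // n /= n5.
    have [_ /(_ (_ : 1 < n.+1)%N)[|a2 _ b_in b_min _]] := fP n.+1 isT; first by lia.
    have [x rx /andP[x_ge x_le]] := @root_near_minus2 R n k n5.
    (* The root near -2 bounds the smallest one from above: being at least -2, it is not -x_M. *)
    rewrite (le_trans (b_min x rx _) x_le) ?andbT; first by lra.
    by move=> _; rewrite gt_eqF //; lra.
  + exact: cvg_cst.
  + have lim0 : (3 * pi / 2 * n.+1%:R^-1 : R) @[n --> \oo] --> (0 : R).
      rewrite -[X in _ --> X](mulr0 (3 * pi / 2)).
      by apply: cvgMl_tmp; exact: cvg_harmonic.
    rewrite -[X in _ --> X](_ : -2 * cos 0 = -2); last by rewrite cos0 mulr1.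
    apply: cvgMl_tmp; apply: continuous_cvg lim0; exact: continuous_cos.
Qed.
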